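(* Let $F$ be a field, $L\ge 1$ an integer, and for $i=1,\ldots,L$ let $b^{(i)}(x),m^{(i)}(x)\in F[x]$ with $\deg m^{(i)}(x)\ge 1$ and $\deg b^{(i)}(x)<\deg m^{(i)}(x)$, and let $\tau^{(i)}\in\mathbb{Z}$ with $0\le\tau^{(i)}\le\deg m^{(i)}(x)$. Then the associated simultaneous partial-inverse (SPI) problem has a solution, i.e., there exists a nonzero polynomial $\Lambda(x)\in F[x]$ of smallest degree among all nonzero polynomials satisfying $\deg\big(b^{(i)}(x)\Lambda(x)\bmod m^{(i)}(x)\big)<\tau^{(i)}$ for all $i\in\{1,\ldots,L\}$.
   Context: Here $a(x)\bmod m(x)$ denotes the remainder of the division of $a(x)$ by $m(x)$. The degree of the zero polynomial is $-\infty$. SPI problem: given $b^{(i)}(x),m^{(i)}(x),\tau^{(i)}$ for $i=1,\ldots,L$ as in the claim, find a nonzero polynomial $\Lambda(x)\in F[x]$ of the smallest degree such that $\deg\big(b^{(i)}(x)\Lambda(x)\bmod m^{(i)}(x)\big)<\tau^{(i)}$ for all $i\in\{1,\ldots,L\}$; such a polynomial is called a solution. *)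

(* Defs.v *)
From HB Require Import structures.
From mathcomp Require Import all_boot all_order all_algebra.
From mathcomp Require Import constructive_ereal.

Set Implicit Arguments.
Unset Strict Implicit.
Unset Printing Implicit Defensive.

Import Order.TTheory GRing.Theory Num.Theory.

Local Open Scope ring_scope.

(* [size p] is [deg p + 1] for [p != 0]; values are taken in [\bar int] so that
   the zero polynomial has degree [-oo]. *)
Definition deg (F : fieldType) (p : {poly F}) : \bar int :=
  if p == 0 then -oo%E else ((size p).-1%:Z)%:E.

Definition SPI_admissible (F : fieldType) (L : nat)
    (b m : 'I_L -> {poly F}) (tau : 'I_L -> int) (Lambda : {poly F}) : Prop :=
  Lambda != 0 /\
  forall i : 'I_L, (deg ((b i * Lambda) %% m i) < (tau i)%:E)%E.

Definition SPI_solution (F : fieldType) (L : nat)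
    (b m : 'I_L -> {poly F}) (tau : 'I_L -> int) (Lambda : {poly F}) : Prop :=
  SPI_admissible b m tau Lambda /\
  forall Lambda' : {poly F},
    SPI_admissible b m tau Lambda' -> (deg Lambda <= deg Lambda')%E.

(* Main.v *)
Require Import Defs.
From Stdlib Require Import Classical.
From HB Require Import structures.
From mathcomp Require Import all_boot all_order all_algebra.
From mathcomp Require Import constructive_ereal.

(* The product of all the moduli is admissible, since every remainder vanishes;
   a solution is then an admissible polynomial of least degree. *)

Set Implicit Arguments.
Unset Strict Implicit.
Unset Printing Implicit Defensive.

Import Order.TTheory GRing.Theory Num.Theory.

Local Open Scope ring_scope.

(** Nonzero polynomials have degrees in the naturals, so by well-ordering a solution exists once
    some polynomial is admissible. [SPI_admissible_prod] supplies one, [ex_argmin_nat] minimises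
    [size], and [deg_le_size] carries minimality over to [deg]. *)

Lemma ex_argmin_nat (T : Type) (P : T -> Prop) (f : T -> nat) (x : T) :
  P x -> exists y, P y /\ forall z, P z -> (f y <= f z)%N.
Proof.
have [n] := ubnP (f x); elim: n x => // n IHn x lt_fx Px.
(* Descent on the bound [n]: either some [z] does strictly better, or [x] is already minimal. [P] is
   an arbitrary proposition, hence excluded middle. *)
case: (classic (exists2 z, P z & (f z < f x)%N)) => [[z Pz lt_zx]|min_x].
  exact: (IHn z (leq_trans lt_zx lt_fx) Pz).
exists x; split=> // z Pz; rewrite leqNgt; apply/negP => lt_zx.
by apply: min_x; exists z.
Qed.

Lemma deg_ge1_neq0 (F : fieldType) (p : {poly F}) : (1%:E <= deg p)%E -> p != 0.
Proof. by rewrite /deg; case: eqP. Qed.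

Lemma deg_le_size (F : fieldType) (p q : {poly F}) :
  q != 0 -> (size p <= size q)%N -> (deg p <= deg q)%E.
Proof.
rewrite /deg => /negbTE -> le_pq; case: ifP => _; first exact: leNye.
by rewrite lee_fin lez_nat -!subn1 leq_sub2r.
Qed.

Lemma SPI_admissible_prod (F : fieldType) (L : nat)
    (b m : 'I_L -> {poly F}) (tau : 'I_L -> int) :
  (forall i, m i != 0) -> SPI_admissible b m tau (\prod_i m i).
Proof.
move=> m_neq0; split; first by apply/prodf_neq0 => i _.
(* Pulling the factor [m i] out front makes the remainder 0, whose degree [-oo] lies below every
   integer [tau i], even 0. *)
move=> i; rewrite (bigD1 i) //= mulrCA modp_mulr /deg eqxx.
exact: ltNyr.
Qed.

Theorem proposition1 (F : fieldType) (L : nat) (hL : (1 <= L)%N)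
    (b m : 'I_L -> {poly F}) (tau : 'I_L -> int)
    (hm : forall i : 'I_L, (1%:E <= deg (m i))%E)
    (hb : forall i : 'I_L, (deg (b i) < deg (m i))%E)
    (htau0 : forall i : 'I_L, 0 <= tau i)
    (htau : forall i : 'I_L, ((tau i)%:E <= deg (m i))%E) :
  exists Lambda : {poly F}, SPI_solution b m tau Lambda.
Proof.
have adm := SPI_admissible_prod b tau (fun i => deg_ge1_neq0 (hm i)).
have [Lambda [admL minL]] :=
  ex_argmin_nat (fun p : {poly F} => size p) adm.
exists Lambda; split=> // q admq.
(* Competitors [q] are nonzero by admissibility, as [deg_le_size] asks. *)
by apply: deg_le_size (minL q admq); case: admq.
Qed.
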